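(* The algebra $K[X]$ is a polynomial algebra on the set of all (equivalence classes of) connected closed diagrams which do not contain $\mathrm{Id}_W$.
   Context: $K$ is an algebraically closed field of characteristic zero and a type $((p_1,q_1),\ldots,(p_r,q_r))\in(\mathbb{N}^2)^r$ is fixed. An algebraic structure of this type is a finite dimensional $K$-vector space $W$ with tensors $x_i\in W^{p_i,q_i}=W^{\otimes p_i}\otimes(W^* )^{\otimes q_i}\cong\mathrm{Hom}_K(W^{\otimes q_i},W^{\otimes p_i})$, $i=1,\ldots,r$. A closed diagram (without $\mathrm{Id}_W$) is a finite list of boxes, each labelled by one of $x_1,\ldots,x_r$, where a box labelled $x_i$ has $q_i$ ordered input strings and $p_i$ ordered output strings, together with a bijection (connection) from the set of all output strings of all boxes to the set of all input strings of all boxes. Given an algebraic structure $(W,(x_i))$, a closed diagram represents a scalar: take the tensor product of the tensors labelling the boxes and apply the evaluation $W\otimes W^*\to K$ to the copies of $W$ and $W^*$ of each connected pair of an output and an input string. Two closed diagrams are equivalent if they represent the same scalar for every algebraic structure; for diagrams without $\mathrm{Id}_W$ this relation is the one generated by permuting the boxes (carrying along strings and connections). The product $\star$ of two diagrams is juxtaposition (disjoint union); the empty diagram is the unit. $K[X]$ is the free $K$-vector space on the equivalence classes of closed diagrams without boxes labelled $\mathrm{Id}_W$, with the product induced by $\star$. A diagram is connected if it is nonempty and connected as a graph with boxes as vertices and connected strings as edges (equivalently, it is not a product of two nonempty diagrams). *)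

(* Defs.v *)
From HB Require Import structures.
From mathcomp Require Import all_boot all_algebra.
From mathcomp Require Import boolp.
From mathcomp Require Export monalg.

Set Implicit Arguments.
Unset Strict Implicit.
Unset Printing Implicit Defensive.

Import GRing.Theory.
Local Open Scope ring_scope.
Local Open Scope quotient_scope.

Section Tensors.
Variables (K : fieldType) (W : vectType K).

Definition multilinear (V : vectType K) n (f : ('I_n -> V) -> K^o) : Prop :=
  forall (v : 'I_n -> V) (k : 'I_n), linear (fun u : V => f (dfwith v (i := k) u)).

(* As W is finite dimensional, a tensor in W^{p,q} (p factors W, q factors     *)
(* dual to W) is a multilinear form in p covectors and q vectors of W.         *)
Record tensor (p q : nat) := Tensor {
  tensor_fun :> ('I_p -> 'Hom(W, K^o)) -> ('I_q -> W) -> K^o;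
  tensor_multilinear_out : forall v, multilinear (tensor_fun ^~ v);
  tensor_multilinear_in : forall phi, multilinear (tensor_fun phi)
}.

Definition dual_basis (i : 'I_(\dim {:W})) : 'Hom(W, K^o) :=
  linfun (coord (vbasis {:W}) i : W -> K^o).

End Tensors.

Section Diagrams.
Variables (r : nat) (tau : r.-tuple (nat * nat)).

Definition nout (i : 'I_r) : nat := (tnth tau i).1.
Definition nin (i : 'I_r) : nat := (tnth tau i).2.

Definition strings (a : 'I_r -> nat) n (lab : 'I_n -> 'I_r) : finType :=
  {k : 'I_n & 'I_(a (lab k))}.

Record diagram := Diagram {
  nbox : nat;
  label : 'I_nbox -> 'I_r;
  link : strings nout label -> strings nin label;
  link_bij : bijective link
}.

HB.instance Definition _ := gen_eqMixin diagram.
HB.instance Definition _ := gen_choiceMixin diagram.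

Definition adjacent (D : diagram) (k l : 'I_(nbox D)) : bool :=
  [exists s : strings nout (@label D),
     ((tag s == k) && (tag (link s) == l))
  || ((tag s == l) && (tag (link s) == k))].

Definition connected (D : diagram) : bool :=
  (0 < nbox D)%N && [forall k, forall l, connect (@adjacent D) k l].

Definition empty_label (k : 'I_0) : 'I_r := match notF (ltn_ord k) with end.

Definition empty_link (s : strings nout empty_label) :
    strings nin empty_label :=
  match notF (ltn_ord (tag s : 'I_0)) with end.

Lemma empty_link_bij : bijective empty_link.
Proof.
by exists (fun s => match notF (ltn_ord (tag s : 'I_0)) with end) => -[[]].
Qed.

Definition empty_diagram : diagram := Diagram empty_link_bij.

Section Juxtaposition.
Variables (n1 n2 : nat) (lab1 : 'I_n1 -> 'I_r) (lab2 : 'I_n2 -> 'I_r).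

Definition case_label (u : 'I_n1 + 'I_n2) : 'I_r :=
  match u with inl k => lab1 k | inr k => lab2 k end.

Definition juxt_label (k : 'I_(n1 + n2)) : 'I_r := case_label (split k).

Variable a : 'I_r -> nat.

Definition split_string (s : strings a juxt_label) :
    strings a lab1 + strings a lab2 :=
  let: existT k j := s in
  match split k as u return
    'I_(a (case_label u)) -> strings a lab1 + strings a lab2
  with
  | inl k1 => fun j => inl (existT _ k1 j)
  | inr k2 => fun j => inr (existT _ k2 j)
  end j.

Lemma juxt_label_unsplit u : case_label u = juxt_label (unsplit u).
Proof. by rewrite /juxt_label unsplitK. Qed.

Definition join_at u (j : 'I_(a (case_label u))) : strings a juxt_label :=
  existT _ (unsplit u) (cast_ord (congr1 a (juxt_label_unsplit u)) j).

Definition join_string (t : strings a lab1 + strings a lab2) :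
    strings a juxt_label :=
  match t with
  | inl (existT k1 j) => @join_at (inl k1) j
  | inr (existT k2 j) => @join_at (inr k2) j
  end.

Lemma join_at_split k (j : 'I_(a (juxt_label k))) :
  @join_at (split k) j = existT _ k j.
Proof.
rewrite /join_at; move: (congr1 a _).
rewrite (splitK k) => e; congr existT.
by apply: val_inj.
Qed.

Lemma split_stringK : cancel split_string join_string.
Proof.
case=> k j; rewrite -[RHS]join_at_split /split_string.
by move: j; rewrite /juxt_label; case: (split k).
Qed.

Lemma split_join_at u (j : 'I_(a (case_label u))) :
  split_string (@join_at u j) =
  match u as u return 'I_(a (case_label u)) -> strings a lab1 + strings a lab2
  with
  | inl k1 => fun j => inl (existT _ k1 j)
  | inr k2 => fun j => inr (existT _ k2 j)
  end j.
Proof.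
rewrite /join_at /split_string; move: (congr1 a _).
rewrite /juxt_label unsplitK => e.
by rewrite (_ : cast_ord e j = j) //; apply: val_inj.
Qed.

Lemma join_stringK : cancel join_string split_string.
Proof. by case=> -[k j]; rewrite /join_string split_join_at. Qed.

End Juxtaposition.

Definition juxt_link (D1 D2 : diagram)
    (s : strings nout (juxt_label (@label D1) (@label D2))) :
    strings nin (juxt_label (@label D1) (@label D2)) :=
  join_string (match split_string s with
               | inl s1 => inl (link s1)
               | inr s2 => inr (link s2)
               end).

Lemma juxt_link_bij D1 D2 : bijective (@juxt_link D1 D2).
Proof.
case: (link_bij D1) (link_bij D2) => [g1 g1K gK1] [g2 g2K gK2].
exists (fun s => join_string (match split_string s with
               | inl s1 => inl (g1 s1) | inr s2 => inr (g2 s2) end)).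
  move=> s; rewrite /juxt_link join_stringK -[RHS]split_stringK.
  by case: (split_string s) => t; rewrite ?g1K ?g2K.
move=> s; rewrite /juxt_link join_stringK -[RHS]split_stringK.
by case: (split_string s) => t; rewrite ?gK1 ?gK2.
Qed.

Definition juxt (D1 D2 : diagram) : diagram := Diagram (@juxt_link_bij D1 D2).

Variable K : fieldType.

Record alg_structure := AlgStructure {
  carrier : vectType K;
  tensors : forall i : 'I_r, tensor carrier (nout i) (nin i)
}.

(* The contraction computed in a basis of W: c assigns a basis vector to every *)
(* input string, and an output string carries the dual basis covector of the   *)
(* input string it is connected to.                                            *)
Definition scalar (A : alg_structure) (D : diagram) : K :=
  \sum_(c : {ffun strings nin (@label D) -> 'I_(\dim {:carrier A})})
    \prod_(k < nbox D)
      tensors A (label k)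
        (fun j => dual_basis (c (link (Tagged _ j))))
        (fun j => (vbasis {:carrier A})`_(c (Tagged _ j))).

Lemma tensors_cast (A : alg_structure) i i' (e : i = i') phi v :
  tensors A i' phi v =
  tensors A i (fun j => phi (cast_ord (congr1 nout e) j))
              (fun j => v (cast_ord (congr1 nin e) j)).
Proof.
case: _ / e phi v => phi v; congr (tensors A i _ _).
  by apply: functional_extensionality_dep => j; rewrite cast_ord_id.
by apply: functional_extensionality_dep => j; rewrite cast_ord_id.
Qed.

Lemma scalar_nbox0 (A : alg_structure) D : nbox D = 0 -> scalar A D = 1.
Proof.
case: D => n lab lk bij /= n0; subst n.
rewrite /scalar /=.
have noS (s : strings nin lab) : False by case: s => -[].
pose c0 : {ffun strings nin lab -> 'I_(\dim {:carrier A})} :=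
  [ffun s => match noS s with end].
rewrite (big_pred1 c0); first by rewrite big_ord0.
by move=> c /=; apply/esym/eqP/ffunP => s; case: (noS s).
Qed.

Lemma scalar_juxt (A : alg_structure) D1 D2 :
  scalar A (juxt D1 D2) = scalar A D1 * scalar A D2.
Proof.
rewrite /scalar /=.
set l1 := @label D1; set l2 := @label D2.
pose I := 'I_(\dim {:carrier A}).
pose h (c : {ffun strings nin l1 -> I} * {ffun strings nin l2 -> I}) :
    {ffun strings nin (juxt_label l1 l2) -> I} :=
  [ffun s => match split_string s with inl s1 => c.1 s1 | inr s2 => c.2 s2 end].
pose h' (c : {ffun strings nin (juxt_label l1 l2) -> I}) :
    {ffun strings nin l1 -> I} * {ffun strings nin l2 -> I} :=
  ([ffun s => c (join_string (inl s))], [ffun s => c (join_string (inr s))]).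
rewrite (reindex h) /=; last first.
  exists h' => [[c1 c2] _|c _].
    by congr pair; apply/ffunP => s; rewrite !ffunE join_stringK.
  apply/ffunP => s; rewrite !ffunE -[in RHS](split_stringK s).
  by case: (split_string s) => t; rewrite !ffunE.
rewrite big_distrlr pair_bigA /=; apply: eq_bigr => -[c1 c2] _ /=.
rewrite big_split_ord /=; congr (_ * _); apply: eq_bigr => k _.
- rewrite (@tensors_cast A _ _ (juxt_label_unsplit l1 l2 (inl k))).
  congr (tensors A _ _ _); apply: functional_extensionality_dep => j.
    rewrite ffunE /juxt_link join_stringK.
    by rewrite (@split_join_at _ _ l1 l2 _ (inl k) j).
  by rewrite ffunE (@split_join_at _ _ l1 l2 _ (inl k) j).
- rewrite (@tensors_cast A _ _ (juxt_label_unsplit l1 l2 (inr k))).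
  congr (tensors A _ _ _); apply: functional_extensionality_dep => j.
    rewrite ffunE /juxt_link join_stringK.
    by rewrite (@split_join_at _ _ l1 l2 _ (inr k) j).
  by rewrite ffunE (@split_join_at _ _ l1 l2 _ (inr k) j).
Qed.

Lemma zero_multilinear (V : vectType K) n :
  multilinear (fun _ : 'I_n -> V => 0 : K^o).
Proof. by move=> v k a u1 u2; rewrite scaler0 addr0. Qed.

Definition zero_structure : alg_structure :=
  @AlgStructure K^o (fun i => @Tensor K K^o (nout i) (nin i) (fun _ _ => 0)
    (fun _ => @zero_multilinear _ _) (fun _ => @zero_multilinear _ _)).

Lemma scalar_zero_structure D : scalar zero_structure D = (nbox D == 0)%:R.
Proof.
have [n0|nN0] := eqVneq (nbox D) 0; first exact: scalar_nbox0.
rewrite /scalar big1 // => c _; move: nN0; rewrite -lt0n => n_gt0.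
by rewrite (bigD1 (Ordinal n_gt0)) //= mul0r.
Qed.

Definition diag_equiv (D1 D2 : diagram) : bool :=
  `[< forall A : alg_structure, scalar A D1 = scalar A D2 >].

Lemma diag_equiv_class : equiv_class_of diag_equiv.
Proof.
split=> [D|D1 D2|D2 D1 D3].
- exact/asboolP.
- by apply/idP/idP => /asboolP e; apply/asboolP => A; rewrite e.
- by move=> /asboolP e1 /asboolP e2; apply/asboolP => A; rewrite e1 e2.
Qed.

Canonical diag_equiv_rel := EquivRelPack diag_equiv_class.

Definition diag_class := {eq_quot diag_equiv_rel}.
HB.instance Definition _ := Choice.on diag_class.
HB.instance Definition _ := EqQuotient.on diag_class.

Implicit Types (D : diagram) (x y : diag_class).

Lemma diag_equivP D1 D2 :
  reflect (forall A : alg_structure, scalar A D1 = scalar A D2)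
          (D1 == D2 %[mod diag_class]).
Proof. by rewrite eqmodE; apply: asboolP. Qed.

Lemma scalar_repr (A : alg_structure) D :
  scalar A (repr (\pi_diag_class D)) = scalar A D.
Proof. by apply/diag_equivP: A; rewrite reprK. Qed.

Definition class_one : diag_class := \pi_diag_class empty_diagram.
Definition class_mul x y : diag_class := \pi_diag_class (juxt (repr x) (repr y)).

Lemma class_mul_pi D1 D2 :
  class_mul (\pi_diag_class D1) (\pi_diag_class D2) =
  \pi_diag_class (juxt D1 D2).
Proof.
by apply/eqP/diag_equivP => A; rewrite !scalar_juxt !scalar_repr.
Qed.

Fact class_mulA : associative class_mul.
Proof.
elim/quotW=> D1; elim/quotW=> D2; elim/quotW=> D3; rewrite !class_mul_pi.
by apply/eqP/diag_equivP => A; rewrite !(scalar_juxt, scalar_repr) mulrA.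
Qed.

Fact class_mulC : commutative class_mul.
Proof.
elim/quotW=> D1; elim/quotW=> D2; rewrite !class_mul_pi.
by apply/eqP/diag_equivP => A; rewrite !(scalar_juxt, scalar_repr) mulrC.
Qed.

Fact class_mul1 : left_id class_one class_mul.
Proof.
elim/quotW=> D; rewrite class_mul_pi.
by apply/eqP/diag_equivP => A; rewrite !(scalar_juxt, scalar_repr) scalar_nbox0 ?mul1r.
Qed.

Fact class_mulr1 : right_id class_one class_mul.
Proof. by move=> x; rewrite class_mulC class_mul1. Qed.

Fact class_unit x y :
  class_mul x y = class_one -> x = class_one /\ y = class_one.
Proof.
elim/quotW: x => D1; elim/quotW: y => D2; rewrite class_mul_pi.
move=> /eqP/diag_equivP/(_ zero_structure).
rewrite !(scalar_juxt, scalar_repr) !scalar_zero_structure eqxx.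
have [n1|_] := eqVneq (nbox D1) 0; last by rewrite mul0r => /esym/eqP/[!oner_eq0].
have [n2|_] := eqVneq (nbox D2) 0; last by rewrite mulr0 => /esym/eqP/[!oner_eq0].
by move=> _; split; apply/eqP/diag_equivP => A; rewrite !scalar_nbox0.
Qed.

HB.instance Definition _ := Choice_isMonomialDef.Build diag_class
  class_mulA class_mul1 class_mulr1 class_unit.
HB.instance Definition _ := MonomialDef_isConomialDef.Build diag_class
  class_mulC.

Definition connected_class : {pred diag_class} :=
  fun x => `[< exists2 D, connected D & x = \pi_diag_class D >].

Definition connected_diag := {x : diag_class | connected_class x}.
HB.instance Definition _ := Choice.on connected_diag.
HB.instance Definition _ := SubType.on connected_diag.

End Diagrams.

Arguments diag_class {r} tau K.
Arguments connected_diag {r} tau K.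

Definition diagram_algebra r (tau : r.-tuple (nat * nat)) (K : fieldType) :=
  {malg K[diag_class tau K]}.
HB.instance Definition _ r tau K :=
  GRing.ComAlgebra.on (@diagram_algebra r tau K).

Definition diag_vec r (tau : r.-tuple (nat * nat)) (K : fieldType)
  (x : diag_class tau K) : diagram_algebra tau K := << x >>.

(* Main.v *)
(* A map f from the boxes of E to the boxes of D determines the images of all
   strings, so a morphism E -> D is a covering of directed graphs; in particular
   it maps a connected diagram onto a connected component.

   Equal scalars imply isomorphic diagrams: take for W the space spanned by the
   input strings of D and for x_i the sum, over the boxes with label i in a set S
   of boxes of D, of the elementary tensors read off the connections of D. Then E
   evaluates to the number of morphisms E -> D with image in S, so by
   inclusion-exclusion the scalars determine the number of surjective morphisms
   E -> D in K. In characteristic 0 this yields surjections in both directions,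
   hence an isomorphism.

   Unique factorization: for C connected, the number of embeddings C -> D is
   additive under juxtaposition and, for D connected, nonzero iff D is isomorphic
   to C; so these numbers recover the multiplicities of the components of D. *)

From HB Require Import structures.
Require Import Defs.
From mathcomp Require Import all_boot all_algebra.
From mathcomp Require Import finmap boolp.
From mathcomp Require Import monalg.

Set Implicit Arguments.
Unset Strict Implicit.
Unset Printing Implicit Defensive.

Import GRing.Theory.
Local Open Scope ring_scope.

(** * Images of strings under maps of boxes *)

Section Lifts.
Variables (r : nat) (a : 'I_r -> nat).

(* t is the image of s: the numbers of s and t within their boxes are compared *)
(* as naturals, because their ordinal types agree only up to an equality of    *)
(* labels.                                                                     *)
Definition lifts n1 n2 (lab1 : 'I_n1 -> 'I_r) (lab2 : 'I_n2 -> 'I_r)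
    (f : 'I_n1 -> 'I_n2) (s : strings a lab1) (t : strings a lab2) : bool :=
  (tag t == f (tag s)) && (tagged t == tagged s :> nat).

Lemma string_eq n (lab : 'I_n -> 'I_r) (s t : strings a lab) :
  tag s = tag t -> tagged s = tagged t :> nat -> s = t.
Proof.
case: s t => [k i] [l j] /= e; case: l / e j => j /= e.
by congr existT; apply: val_inj.
Qed.

Variables (n1 n2 : nat) (lab1 : 'I_n1 -> 'I_r) (lab2 : 'I_n2 -> 'I_r).
Variable f : 'I_n1 -> 'I_n2.
Implicit Types (s : strings a lab1) (t : strings a lab2).

Lemma liftsP s t :
  reflect (tag t = f (tag s) /\ tagged t = tagged s :> nat) (lifts f s t).
Proof. by apply: (iffP andP) => -[h1 h2]; split; apply/eqP. Qed.

Lemma lifts_tag s t : lifts f s t -> tag t = f (tag s).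
Proof. by case/liftsP. Qed.

Lemma lifts_fun s t t' : lifts f s t -> lifts f s t' -> t = t'.
Proof.
move=> /liftsP[e1 e2] /liftsP[e1' e2'].
by apply: string_eq; [rewrite e1 | rewrite e2].
Qed.

Lemma lifts_inj s s' t : injective f -> lifts f s t -> lifts f s' t -> s = s'.
Proof.
move=> f_inj /liftsP[e1 e2] /liftsP[e1' e2'].
by apply: string_eq; [apply: f_inj; rewrite -e1|rewrite -e2].
Qed.

Hypothesis lab_f : forall k, lab2 (f k) = lab1 k.

Lemma lifts_ex s : exists t : strings a lab2, lifts f s t.
Proof.
exists (Tagged (fun k => 'I_(a (lab2 k)))
         (cast_ord (congr1 a (esym (lab_f (tag s)))) (tagged s))).
exact/liftsP.
Qed.

(** The covering property: a string at [f k] lifts to one at any prescribed box [k] of the fibre,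
    because equal labels give equal numbers of strings. *)
Lemma lifts_fiber k t : tag t = f k ->
  exists2 s : strings a lab1, tag s = k & lifts f s t.
Proof.
move=> e; have e' : lab2 (tag t) = lab1 k by rewrite e lab_f.
exists (Tagged (fun k => 'I_(a (lab1 k))) (cast_ord (congr1 a e') (tagged t))) => //.
exact/liftsP.
Qed.

End Lifts.

Lemma lifts_comp r (a : 'I_r -> nat) n1 n2 n3 (lab1 : 'I_n1 -> 'I_r)
    (lab2 : 'I_n2 -> 'I_r) (lab3 : 'I_n3 -> 'I_r)
    (f : 'I_n1 -> 'I_n2) (g : 'I_n2 -> 'I_n3)
    (s : strings a lab1) (t : strings a lab2) (u : strings a lab3) :
  lifts f s t -> lifts g t u -> lifts (g \o f) s u.
Proof.
move=> /liftsP[e1 e2] /liftsP[e1' e2'].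
by apply/liftsP; split; [rewrite e1' /= e1 | rewrite e2'].
Qed.

(** * Morphisms and isomorphisms of diagrams *)

Section Homs.
Variables (r : nat) (tau : r.-tuple (nat * nat)).
Implicit Types C D E : diagram tau.

Definition is_hom D E (f : 'I_(nbox D) -> 'I_(nbox E)) : bool :=
  [forall k, label (f k) == label k] &&
  [forall s : strings (nout tau) (@label _ _ D),
   forall t : strings (nout tau) (@label _ _ E),
     lifts f s t ==> lifts f (link s) (link t)].

Lemma homP D E (f : 'I_(nbox D) -> 'I_(nbox E)) :
  reflect ((forall k, label (f k) = label k) /\
           forall s t, lifts f s t -> lifts f (link s) (link t)) (is_hom f).
Proof.
apply: (iffP andP) => -[h1 h2]; split.
- by move=> k; apply/eqP/(forallP h1).
- by move=> s t; apply/implyP; move/forallP/(_ s)/forallP: h2; apply.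
- by apply/forallP => k; rewrite h1.
- by apply/forallP => s; apply/forallP => t; apply/implyP/h2.
Qed.

Lemma eq_hom D E (f g : 'I_(nbox D) -> 'I_(nbox E)) : f =1 g -> is_hom f = is_hom g.
Proof. by move=> /funext->. Qed.

Lemma hom_id D : is_hom (fun k : 'I_(nbox D) => k).
Proof.
apply/homP; split=> // s t /liftsP[e1 e2].
by rewrite (string_eq e1 e2); apply/liftsP.
Qed.

Lemma hom_comp C D E (f : 'I_(nbox C) -> 'I_(nbox D))
    (g : 'I_(nbox D) -> 'I_(nbox E)) : is_hom f -> is_hom g -> is_hom (g \o f).
Proof.
move=> /homP[lf hf] /homP[lg hg]; apply/homP; split=> [k|s u su].
  by rewrite /= lg lf.
have [t st] := lifts_ex lf s.
have [u' tu'] := lifts_ex lg t.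
rewrite (lifts_fun su (lifts_comp st tu')).
exact: lifts_comp (hf _ _ st) (hg _ _ tu').
Qed.

Lemma hom_inv D E (f : 'I_(nbox D) -> 'I_(nbox E)) g :
  is_hom f -> cancel f g -> cancel g f -> is_hom g.
Proof.
move=> /homP[lf hf] fK gK; apply/homP.
have lV a (s : strings a (@label _ _ D)) (t : strings a (@label _ _ E)) :
    lifts f s t = lifts g t s.
  apply/liftsP/liftsP => -[e1 e2]; split=> //; first by rewrite e1 fK.
  by rewrite e1 gK.
by split=> [k|s t]; [rewrite -{2}(gK k) lf | rewrite -!lV; apply: hf].
Qed.

Lemma hom_factor C D E (g : 'I_(nbox C) -> 'I_(nbox D))
    (i : 'I_(nbox D) -> 'I_(nbox E)) :
  is_hom i -> injective i -> is_hom (i \o g) -> is_hom g.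
Proof.
move=> /homP[li hi] i_inj /homP[lg hg]; apply/homP.
split=> [k|s t st].
  by rewrite -li lg.
have [t' tt'] := lifts_ex li t.
have /liftsP[e1 e2] := hg _ _ (lifts_comp st tt').
have /liftsP[e1' e2'] := hi _ _ tt'.
by apply/liftsP; split; [apply: i_inj; rewrite -e1'|rewrite -e2'].
Qed.

Definition iso D E : Prop :=
  exists2 f : 'I_(nbox D) -> 'I_(nbox E), is_hom f & bijective f.

Lemma iso_sym D E : iso D E -> iso E D.
Proof.
case=> f hf [g fK gK]; exists g; first exact: hom_inv hf fK gK.
by exists f.
Qed.

(** The induced bijection [F] of input strings reindexes the choices of basis vectors, and [f]
    reindexes the boxes. Compatibility with links matches the dual covectors on the output
    strings. *)
Lemma scalar_iso (K : fieldType) (A : alg_structure tau K) D E :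
  iso D E -> Defs.scalar A D = Defs.scalar A E.
Proof.
case=> f /homP[lf hf] f_bij.
have f_inj := bij_inj f_bij.
have [F FP] : exists F : strings (nin tau) (@label _ _ D) ->
                           strings (nin tau) (@label _ _ E),
    forall s, lifts f s (F s).
  by apply: (@fin_all_exists _ (fun=> _) (fun s t => lifts f s t)) => s;
    apply: lifts_ex.
have [G GP] : exists G : strings (nin tau) (@label _ _ E) ->
                           strings (nin tau) (@label _ _ D),
    forall t, lifts f (G t) t.
  apply: (@fin_all_exists _ (fun=> _) (fun t s => lifts f s t)) => t.
  case: f_bij => g fK gK.
  by have [|s _ ?] := lifts_fiber lf (k := g (tag t)) (t := t);
    [rewrite gK | exists s].
have FK : cancel F G by move=> s; apply: lifts_inj f_inj (GP _) (FP _).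
have GK : cancel G F by move=> t; apply: lifts_fun (FP _) (GP _).
rewrite /Defs.scalar.
pose I := 'I_(\dim {:carrier A}).
pose h (c : {ffun strings (nin tau) (@label _ _ E) -> I}) := [ffun s => c (F s)].
rewrite (reindex h) /=; last first.
  exists (fun c => [ffun t => c (G t)]) => c _; apply/ffunP => s.
    by rewrite !ffunE GK.
  by rewrite !ffunE FK.
apply: eq_bigr => c _; rewrite [RHS](reindex f) /=; last exact: onW_bij.
apply: eq_bigr => k _; rewrite (tensors_cast (esym (lf k))).
congr (tensors A _ _ _); apply: funext => j; rewrite ffunE.
  congr (dual_basis (c _)); apply: lifts_fun (FP _) (hf _ _ _).
  exact/liftsP.
congr (_`_(c _)); apply: lifts_fun (FP _) _.
exact/liftsP.
Qed.


(** * Juxtaposition as a coproduct of diagrams *)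

Definition inl_box D E (k : 'I_(nbox D)) : 'I_(nbox (juxt D E)) :=
  lshift (nbox E) k.
Definition inr_box D E (k : 'I_(nbox E)) : 'I_(nbox (juxt D E)) :=
  rshift (nbox D) k.

Section Juxt.
Variables (D E : diagram tau).
Notation joinl a s := (@join_string _ _ _ (@label _ _ D) (@label _ _ E) a (inl s)).
Notation joinr a s := (@join_string _ _ _ (@label _ _ D) (@label _ _ E) a (inr s)).

Lemma inl_box_inj : injective (@inl_box D E).
Proof. exact: lshift_inj. Qed.

Lemma inr_box_inj : injective (@inr_box D E).
Proof. exact: rshift_inj. Qed.

Lemma lifts_inl a (s : strings a (@label _ _ D)) :
  lifts (@inl_box D E) s (joinl a s).
Proof. by case: s => k j; apply/liftsP. Qed.

Lemma lifts_inr a (s : strings a (@label _ _ E)) :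
  lifts (@inr_box D E) s (joinr a s).
Proof. by case: s => k j; apply/liftsP. Qed.

Lemma hom_inl : is_hom (@inl_box D E).
Proof.
apply/homP; split=> [k|s t /(lifts_fun (lifts_inl s)) <-].
  exact: esym (juxt_label_unsplit _ _ (inl k)).
by rewrite -[link _ in X in lifts _ _ X]/(juxt_link _) /juxt_link
  join_stringK;
  apply: lifts_inl.
Qed.

Lemma hom_inr : is_hom (@inr_box D E).
Proof.
apply/homP; split=> [k|s t /(lifts_fun (lifts_inr s)) <-].
  exact: esym (juxt_label_unsplit _ _ (inr k)).
by rewrite -[link _ in X in lifts _ _ X]/(juxt_link _) /juxt_link
  join_stringK;
  apply: lifts_inr.
Qed.

Variant juxt_string_spec a :
    strings a (juxt_label (@label _ _ D) (@label _ _ E)) -> Prop :=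
| JuxtInl (s : strings a (@label _ _ D)) t
    of lifts (@inl_box D E) s t : juxt_string_spec t
| JuxtInr (s : strings a (@label _ _ E)) t
    of lifts (@inr_box D E) s t : juxt_string_spec t.

Lemma juxt_stringP a t : @juxt_string_spec a t.
Proof.
rewrite -[t]split_stringK; case: (split_string t) => s.
  exact/JuxtInl/lifts_inl.
exact/JuxtInr/lifts_inr.
Qed.

Definition case_box C (f : 'I_(nbox D) -> 'I_(nbox C))
    (g : 'I_(nbox E) -> 'I_(nbox C)) (k : 'I_(nbox (juxt D E))) :=
  match split k with inl k1 => f k1 | inr k2 => g k2 end.

Lemma case_box_inl C (f : 'I_(nbox D) -> 'I_(nbox C)) g k :
  case_box f g (@inl_box D E k) = f k.
Proof. by rewrite /case_box (unsplitK (inl k)). Qed.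

Lemma case_box_inr C (f : 'I_(nbox D) -> 'I_(nbox C)) g k :
  case_box f g (@inr_box D E k) = g k.
Proof. by rewrite /case_box (unsplitK (inr k)). Qed.

Variant juxt_box_spec : 'I_(nbox (juxt D E)) -> Prop :=
| JuxtBoxInl k : juxt_box_spec (@inl_box D E k)
| JuxtBoxInr k : juxt_box_spec (@inr_box D E k).

Lemma juxt_boxP k : juxt_box_spec k.
Proof. by rewrite -[k]splitK; case: split => k'; constructor. Qed.

Lemma inl_inr_box k l : @inl_box D E k <> @inr_box D E l.
Proof.
move/(congr1 val) => /= e.
by have := ltn_ord k; rewrite e ltnNge leq_addr.
Qed.

Lemma hom_case C (f : 'I_(nbox D) -> 'I_(nbox C))
    (g : 'I_(nbox E) -> 'I_(nbox C)) :
  is_hom f -> is_hom g -> is_hom (case_box f g).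
Proof.
move=> /homP[lf hf] /homP[lg hg].
have /homP[ll hl] := hom_inl; have /homP[lr hr] := hom_inr.
apply/homP; split=> [k|t u].
  by case: (juxt_boxP k) => k'; rewrite ?case_box_inl ?case_box_inr ?ll ?lr.
have lc a (s : strings a (@label _ _ D)) t' (u' : strings a (@label _ _ C)) :
    lifts (@inl_box D E) s t' -> lifts (case_box f g) t' u' = lifts f s u'.
  by move=> /liftsP[e1 e2]; rewrite /lifts e2; congr (_ && _);
       rewrite e1 case_box_inl.
have rc a (s : strings a (@label _ _ E)) t' (u' : strings a (@label _ _ C)) :
    lifts (@inr_box D E) s t' -> lifts (case_box f g) t' u' = lifts g s u'.
  by move=> /liftsP[e1 e2]; rewrite /lifts e2; congr (_ && _);
       rewrite e1 case_box_inr.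
case: (juxt_stringP t) => s {}t st.
  by rewrite (lc _ _ _ _ _ st) (lc _ _ _ _ _ (hl _ _ st)); apply: hf.
by rewrite (rc _ _ _ _ _ st) (rc _ _ _ _ _ (hr _ _ st)); apply: hg.
Qed.

End Juxt.

(** * Connected components *)

(** No link enters or leaves [S], so both [link] and its inverse restrict to the strings of the
    boxes in [S]; the boxes are renumbered by [enum_val]. *)
Lemma closed_subdiagram D (S : {set 'I_(nbox D)}) :
  (forall s, (tag (link s) \in S) = (tag s \in S)) ->
  exists (E : diagram tau) (f : 'I_(nbox E) -> 'I_(nbox D)),
    [/\ is_hom f, injective f, nbox E = #|S|
      & forall k, (k \in S) = (k \in codom f)].
Proof.
move=> S_closed.
pose e (k : 'I_#|S|) : 'I_(nbox D) := enum_val k.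
pose lab k := label (e k).
have e_inj : injective e := @enum_val_inj _ _.
have eS k : (k \in S) = (k \in codom e).
  apply/idP/codomP => [kS|[k' ->]]; last exact: enum_valP.
  by exists (enum_rank_in kS k); rewrite /e enum_rankK_in.
have lab_e k : label (e k) = lab k by [].
have liftS a (t : strings a (@label _ _ D)) :
    tag t \in S -> exists s : strings a lab, lifts e s t.
  by rewrite eS => /codomP[k /(lifts_fiber lab_e)[s _ ?]]; exists s.
have tagS a (s : strings a lab) t : lifts e s t -> tag t \in S.
  by move=> /lifts_tag->; apply: enum_valP.
(* [lab k] unfolds to [label (e k)], so the string number needs no cast here. *)
pose up a (s : strings a lab) : strings a (@label _ _ D) :=
  Tagged (fun k => 'I_(a (label k))) (tagged s : 'I_(a (label (e (tag s))))).
have upP a (s : strings a lab) : lifts e s (up a s) by apply/liftsP.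
have [lk lkP] : exists lk : strings (nout tau) lab -> strings (nin tau) lab,
    forall s, lifts e (lk s) (link (up _ s)).
  apply: (@fin_all_exists _ (fun=> _)
    (fun s t => lifts e t (link (up _ s)))) => s.
  by apply: liftS; rewrite S_closed; apply: tagS (upP _ s).
have [lkV lkVK linkK] := link_bij D.
have [lk' lk'P] : exists lk' : strings (nin tau) lab -> strings (nout tau) lab,
    forall s, lifts e (lk' s) (lkV (up _ s)).
  apply: (@fin_all_exists _ (fun=> _)
    (fun s t => lifts e t (lkV (up _ s)))) => s.
  by apply: liftS; rewrite -S_closed linkK; apply: tagS (upP _ s).
have lk_bij : bijective lk.
  exists lk' => s.
    apply: lifts_inj e_inj (lk'P _) _.
    by rewrite (lifts_fun (upP _ _) (lkP s)) lkVK.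
  apply: lifts_inj e_inj (lkP _) _.
  by rewrite (lifts_fun (upP _ _) (lk'P s)) linkK.
exists (Diagram lk_bij), e; split=> //.
apply/homP; split=> // s t st.
by rewrite (lifts_fun st (upP _ s)); apply: lkP.
Qed.

Lemma iso_juxt_closed D (S : {set 'I_(nbox D)}) :
  (forall s, (tag (link s) \in S) = (tag s \in S)) ->
  exists D1 D2, [/\ iso (juxt D1 D2) D, nbox D1 = #|S| & nbox D2 = #|~: S|].
Proof.
move=> S_closed.
have [D1 [f1 [hf1 f1_inj n1 S1]]] := closed_subdiagram S_closed.
have [|D2 [f2 [hf2 f2_inj n2 S2]]] := @closed_subdiagram D (~: S).
  by move=> s; rewrite !inE S_closed.
exists D1, D2; split=> //; exists (case_box f1 f2); first exact: hom_case.
apply: inj_card_bij; last by rewrite !card_ord /= n1 n2 cardsC card_ord.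
have f12 k l : f1 k <> f2 l.
  move=> e; have := S2 (f2 l); rewrite codom_f inE -e S1 codom_f //.
move=> k l; case: (juxt_boxP k) => k'; case: (juxt_boxP l) => l';
  rewrite ?case_box_inl ?case_box_inr.
- by move/f1_inj->.
- by move/f12.
- by move/esym/f12.
- by move/f2_inj->.
Qed.

Lemma not_connected_split D : (0 < nbox D)%N -> ~~ connected D ->
  exists D1 D2, [/\ iso (juxt D1 D2) D, (nbox D1 < nbox D)%N
    & (nbox D2 < nbox D)%N].
Proof.
move=> D_gt0; rewrite /connected D_gt0 /= => /forallPn[k /forallPn[l kNl]].
pose S := [set x | connect (@adjacent _ _ D) k x].
have S_closed s : (tag (link s) \in S) = (tag s \in S).
  rewrite !inE; apply/idP/idP => /connect_trans; apply; apply: connect1;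
    by apply/existsP; exists s; rewrite !eqxx ?orbT.
have [D1 [D2 [i12 n1 n2]]] := iso_juxt_closed S_closed.
(* [k] and [l] show that the component and its complement are both nonempty, so each piece is
   strictly smaller than [D]. *)
have S_gt0 : (0 < #|S|)%N by apply/card_gt0P; exists k; rewrite inE.
have SC_gt0 : (0 < #|~: S|)%N by apply/card_gt0P; exists l; rewrite !inE.
have := cardsC S; rewrite card_ord => Sn.
exists D1, D2; rewrite n1 n2; split=> //.
  by rewrite -[ltnRHS]Sn -[ltnLHS]addn0 ltn_add2l.
by rewrite -[ltnRHS]Sn -[ltnLHS]add0n ltn_add2r.
Qed.

Lemma connected_ind D (P : pred 'I_(nbox D)) k0 : connected D ->
  (forall s, P (tag (link s)) = P (tag s)) -> P k0 -> forall k, P k.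
Proof.
move=> /andP[_ /forallP/(_ k0)/forallP D_conn] P_closed Pk0 k.
have cl : closed (@adjacent _ _ D) P.
  move=> x y /existsP[s /orP[]/andP[/eqP<- /eqP<-]]; rewrite unfold_in.
    by rewrite [RHS]P_closed.
  by rewrite [LHS]P_closed.
by have := closed_connect cl (D_conn k); rewrite !unfold_in Pk0 => <-.
Qed.

(** The image of a morphism is closed under links in both directions, hence is all of a connected
    target once it is nonempty. *)
Lemma hom_connected_surj C E (f : 'I_(nbox C) -> 'I_(nbox E)) :
  (0 < nbox C)%N -> connected E -> is_hom f -> forall k, k \in codom f.
Proof.
move=> C_gt0 E_conn /homP[lf hf] k.
apply: (connected_ind E_conn _ (codom_f f (Ordinal C_gt0))) => t {k}.
apply/codomP/codomP => -[k e].
  (* Going backwards along a link: lift [link t] to an input string [s'] of [C] and take its partner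
     [h s']. The image of [h s'] has the same link as [t], so it is [t]. *)
  have [s' _ s't] := lifts_fiber lf e.
  have [g gK _] := link_bij E; have [h _ hK] := link_bij C.
  have [t0 t0P] := lifts_ex lf (h s').
  have /lifts_tag -> : lifts f (h s') t; last by exists (tag (h s')).
  rewrite -[t]gK (_ : link t = link t0) ?gK //.
  by apply: lifts_fun s't _; rewrite -{1}(hK s'); apply: hf.
have [s _ st] := lifts_fiber lf e.
by exists (tag (link s)); have /liftsP[] := hf _ _ st.
Qed.

(** Whether [f] sends a box to the left summand does not change along links of [C], so one box of
    [C] decides for all. *)
Lemma hom_juxt_connected C D E (f : 'I_(nbox C) -> 'I_(nbox (juxt D E))) :
  connected C -> is_hom f ->
  (exists2 g : 'I_(nbox C) -> 'I_(nbox D), is_hom g & f =1 @inl_box D E \o g) \/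
  (exists2 g : 'I_(nbox C) -> 'I_(nbox E), is_hom g & f =1 @inr_box D E \o g).
Proof.
move=> C_conn hf; have /homP[lf liftf] := hf.
have C_gt0 : (0 < nbox C)%N by case/andP: C_conn.
have /homP[_ hl] := hom_inl D E; have /homP[_ hr] := hom_inr D E.
have cl s : (f (tag (link s)) \in codom (@inl_box D E)) =
            (f (tag s) \in codom (@inl_box D E)).
  have [t st] := lifts_ex lf s.
  have /lifts_tag <- := st; have /lifts_tag <- := liftf _ _ st.
  case: (juxt_stringP t) => u {st}t ut.
    by have /lifts_tag -> := ut; have /lifts_tag -> := hl _ _ ut; rewrite !codom_f.
  have /lifts_tag -> := ut; have /lifts_tag -> := hr _ _ ut.
  by apply/codomP/codomP => -[k /esym/inl_inr_box].
have clN s : ~~ (f (tag (link s)) \in codom (@inl_box D E)) =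
            ~~ (f (tag s) \in codom (@inl_box D E)) by rewrite cl.
case: (boolP (f (Ordinal C_gt0) \in codom (@inl_box D E))) => f0; [left|right].
  have /fin_all_exists[g fg] : forall k, exists x, f k = @inl_box D E x.
    move=> k; apply/codomP.
    exact: (connected_ind (P := fun k => f k \in codom (@inl_box D E))
      C_conn cl f0).
  exists g => //; apply: hom_factor (hom_inl D E) (@inl_box_inj D E) _.
  by rewrite -(eq_hom fg).
have /fin_all_exists[g fg] : forall k, exists x, f k = @inr_box D E x.
  move=> k.
  have := connected_ind (P := fun k => f k \notin codom (@inl_box D E))
    C_conn clN f0 k.
  case: (juxt_boxP (f k)) => x; last by exists x.
  by rewrite codom_f.
exists g => //; apply: hom_factor (hom_inr D E) (@inr_box_inj D E) _.
by rewrite -(eq_hom fg).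
Qed.

End Homs.

(** * Counting embeddings *)

Section Embeddings.
Variables (r : nat) (tau : r.-tuple (nat * nat)).
Implicit Types C D E : diagram tau.

Definition embeddings C E : {set {ffun 'I_(nbox C) -> 'I_(nbox E)}} :=
  [set f : {ffun _} | is_hom f && injectiveb f].

Lemma embeddingsP C E (f : {ffun 'I_(nbox C) -> 'I_(nbox E)}) :
  reflect (is_hom f /\ injective f) (f \in embeddings C E).
Proof. by rewrite inE; apply: (iffP andP) => -[? /injectiveP]. Qed.

Definition post C D E (h : 'I_(nbox D) -> 'I_(nbox E))
    (f : {ffun 'I_(nbox C) -> 'I_(nbox D)}) : {ffun 'I_(nbox C) -> 'I_(nbox E)} :=
  [ffun k => h (f k)].

Lemma post_inj C D E h : injective h -> injective (@post C D E h).
Proof.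
move=> h_inj f g /ffunP fg; apply/ffunP => k.
by have := fg k; rewrite !ffunE => /h_inj.
Qed.

Lemma post_embedding C D E h f :
  is_hom h -> injective h -> f \in embeddings C D ->
  @post C D E h f \in embeddings C E.
Proof.
move=> hh h_inj /embeddingsP[hf f_inj]; apply/embeddingsP; split.
  rewrite (@eq_hom _ _ _ _ _ (h \o f)); first exact: hom_comp.
  by move=> k; rewrite ffunE.
by move=> k l; rewrite !ffunE => /h_inj/f_inj.
Qed.

Lemma leq_card_embeddings C D E (h : 'I_(nbox D) -> 'I_(nbox E)) :
  is_hom h -> injective h -> (#|embeddings C D| <= #|embeddings C E|)%N.
Proof.
move=> hh h_inj; rewrite -(card_imset _ (@post_inj C _ _ _ h_inj)).
by apply/subset_leq_card/subsetP => _ /imsetP[f fP ->]; apply: post_embedding.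
Qed.

Lemma card_embeddings_iso C D E :
  iso D E -> #|embeddings C D| = #|embeddings C E|.
Proof.
move=> i; have [g hg /bij_inj g_inj] := iso_sym i.
case: i => f hf /bij_inj f_inj.
by apply/eqP; rewrite eqn_leq (leq_card_embeddings _ hf f_inj)
  (leq_card_embeddings _ hg g_inj).
Qed.

Lemma card_embeddings_juxt C D E : connected C ->
  #|embeddings C (juxt D E)| = (#|embeddings C D| + #|embeddings C E|)%N.
Proof.
move=> C_conn; have C_gt0 : (0 < nbox C)%N by case/andP: C_conn.
have injl := @inl_box_inj _ _ D E; have injr := @inr_box_inj _ _ D E.
rewrite -(card_imset _ (@post_inj C _ _ _ injl)).
rewrite -(card_imset _ (@post_inj C _ _ _ injr)).
(* [C] has a box, which cannot land in both summands, so the two sets of composites are disjoint. *)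
rewrite -cardsUI (_ : _ :&: _ = set0) ?cards0 ?addn0; last first.
  apply/setP => f; rewrite !inE; apply/negP => /andP[/imsetP[g _ ->]].
  by move=> /imsetP[g' _ /ffunP/(_ (Ordinal C_gt0))]; rewrite !ffunE => /inl_inr_box.
congr #|pred_of_set _|; apply/setP => f; rewrite in_setU; apply/idP/orP.
  move=> /embeddingsP[hf f_inj].
  have [[g hg fg]|[g hg fg]] := hom_juxt_connected C_conn hf; [left|right];
    apply/imsetP; exists [ffun k => g k].
  - apply/embeddingsP; split.
      by rewrite (@eq_hom _ _ _ _ _ g) // => k; rewrite ffunE.
    by move=> k l; rewrite !ffunE => e; apply: f_inj; rewrite !fg /= e.
  - by apply/ffunP => k; rewrite !ffunE fg.
  - apply/embeddingsP; split.
      by rewrite (@eq_hom _ _ _ _ _ g) // => k; rewrite ffunE.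
    by move=> k l; rewrite !ffunE => e; apply: f_inj; rewrite !fg /= e.
  - by apply/ffunP => k; rewrite !ffunE fg.
by case=> /imsetP[g gP ->]; apply: post_embedding => //;
  [apply: hom_inl|apply: hom_inr].
Qed.

Lemma card_embeddings_self_gt0 C : (0 < #|embeddings C C|)%N.
Proof.
apply/card_gt0P; exists [ffun k => k]; apply/embeddingsP; split.
  by rewrite (@eq_hom _ _ _ _ _ id) ?hom_id // => k; rewrite ffunE.
by move=> k l; rewrite !ffunE.
Qed.

(** A morphism from a nonempty diagram to a connected one is onto, so an embedding is bijective. *)
Lemma embeddings_connected_iso C E :
  (0 < nbox C)%N -> connected E -> (0 < #|embeddings C E|)%N -> iso C E.
Proof.
move=> C_gt0 E_conn /card_gt0P[f /embeddingsP[hf f_inj]]; exists f => //.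
have f_surj := hom_connected_surj C_gt0 E_conn hf.
apply: inj_card_bij f_inj _.
have/subset_leq_card := introT subsetP (fun k (_ : k \in 'I_(nbox E)) => f_surj k).
by move/leq_trans; apply; apply: leq_image_card.
Qed.

End Embeddings.

(** * Algebraic structures given by coordinate arrays *)

Section MultilinearSum.
Variables (K : fieldType) (V : vectType K) (T : finType) (n : nat).
Variables (C : T -> K) (L : T -> 'I_n -> V -> K^o).
Hypothesis L_lin : forall a j, linear (L a j).

Lemma multilinear_sum_prod :
  multilinear (fun v : 'I_n -> V => (\sum_a C a * \prod_j (L a j (v j) : K))%R).
Proof.
move=> v k c u w /=; rewrite scaler_sumr -big_split /=; apply: eq_bigr => a _.
pose P : K := \prod_(j | j != k) (L a j (v j) : K).
have prodE x : \prod_j (L a j (dfwith v (i := k) x j) : K) = (L a k x : K) * P.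
  rewrite (bigD1 k) //= dfwith_in; congr (_ * _); apply: eq_bigr => j jk.
  by rewrite dfwith_out // eq_sym.
rewrite !prodE L_lin.
transitivity (C a * ((c * (L a k u : K) + (L a k w : K)) * P)) => //.
by rewrite mulrDl mulrDr -mulrA mulrCA.
Qed.

End MultilinearSum.

Section ArrayStructure.
Variables (r : nat) (tau : r.-tuple (nat * nat)) (K : fieldType) (X : finType).
Implicit Type D : diagram tau.

Definition array := forall i : 'I_r,
  {ffun 'I_(nout tau i) -> X} -> {ffun 'I_(nin tau i) -> X} -> K.

(** The local factor of a state sum, as in a vertex model: [c] colours the input strings, and an
    output string takes the colour of the input string joined to it. *)
Definition state_weight D (T : array)
    (c : {ffun strings (nin tau) (@label _ _ D) -> X}) (k : 'I_(nbox D)) : K :=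
  T (label k) [ffun j => c (link (Tagged (fun k => 'I_(nout tau (label k))) j))]
              [ffun j => c (Tagged (fun k => 'I_(nin tau (label k))) j)].

(** Take a space of dimension [#|X|], index its basis by [X], and let [T i] be the coordinates of
    the tensor labelled [i]. Evaluation at basis vectors and dual covectors picks out single
    coordinates. *)
Lemma array_structure (T : array) : exists A : alg_structure tau K,
  forall D, Defs.scalar A D =
    \sum_(c : {ffun strings (nin tau) (@label _ _ D) -> X})
      \prod_k state_weight T c k.
Proof.
pose W := 'rV[K]_#|X|.
have dimW : #|X| = \dim {:W} by rewrite dimvf /dim /= mul1n.
have [e [e' [eK eK']]] :
    exists (e : X -> 'I_(\dim {:W})) (e' : 'I_(\dim {:W}) -> X),
    cancel e e' /\ cancel e' e.
  exists (fun x => cast_ord dimW (enum_rank x)).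
  exists (fun i => enum_val (cast_ord (esym dimW) i)).
  by split=> i; rewrite ?cast_ordK ?enum_rankK // enum_valK cast_ordKV.
have L1 p (a : {ffun 'I_p -> X}) j :
    linear (fun phi : 'Hom(W, K^o) => phi (vbasis {:W})`_(e (a j)) : K^o).
  by move=> c u w; rewrite add_lfunE scale_lfunE.
have L2 q (b : {ffun 'I_q -> X}) j :
    linear (coord (vbasis {:W}) (e (b j)) : W -> K^o).
  exact: linearP.
pose t i (phi : 'I_(nout tau i) -> 'Hom(W, K^o)) (v : 'I_(nin tau i) -> W) : K^o :=
  \sum_(a : {ffun 'I_(nout tau i) -> X}) \sum_(b : {ffun 'I_(nin tau i) -> X})
    T i a b * (\prod_j phi j (vbasis {:W})`_(e (a j)) *
               \prod_j coord (vbasis {:W}) (e (b j)) (v j)).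
have t_out i v : multilinear (@t i ^~ v).
  rewrite (_ : @t i ^~ v = fun phi => \sum_a
      (\sum_b T i a b * \prod_j coord (vbasis {:W}) (e (b j)) (v j)) *
      \prod_j phi j (vbasis {:W})`_(e (a j))).
    exact: (multilinear_sum_prod _ (L1 _)).
  apply: funext => phi; apply: eq_bigr => a _; rewrite mulr_suml.
  by apply: eq_bigr => b _; rewrite -mulrA [X in _ * X]mulrC.
have t_in i phi : multilinear (@t i phi).
  rewrite (_ : @t i phi = fun v => \sum_b
      (\sum_a T i a b * \prod_j phi j (vbasis {:W})`_(e (a j))) *
      \prod_j coord (vbasis {:W}) (e (b j)) (v j)).
    exact: (multilinear_sum_prod _ (L2 _)).
  apply: funext => v; rewrite /t exchange_big; apply: eq_bigr => b _.
  by rewrite mulr_suml; apply: eq_bigr => a _; rewrite mulrA.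
exists (@AlgStructure _ _ K W (fun i => Tensor (t_out i) (t_in i))) => D.
rewrite /Defs.scalar /=.
pose h (c : {ffun strings (nin tau) (@label _ _ D) -> X}) := [ffun s => e (c s)].
rewrite (reindex h) /=; last first.
  exists (fun c => [ffun s => e' (c s)]) => c _; apply/ffunP => s.
    by rewrite !ffunE eK.
  by rewrite !ffunE eK'.
apply: eq_bigr => c _; apply: eq_bigr => k _; rewrite /t /state_weight.
have coordE (i j : 'I_(\dim {:W})) :
    coord (vbasis {:W}) i (vbasis {:W})`_j = (i == j)%:R.
  by rewrite coord_free ?(basis_free (vbasisP _)) // eq_sym.
have prodE p (F : 'I_p -> X) (a : {ffun 'I_p -> X}) :
    \prod_j (e (F j) == e (a j))%:R = (a == [ffun j => F j])%:R :> K.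
  case: (pickP (fun j => F j != a j)) => [j jne|all_eq].
    rewrite (bigD1 j) //= (can_eq eK) (negPf jne) mul0r.
    by case: (a =P _) jne => // ->; rewrite ffunE eqxx.
  have -> : a = [ffun j => F j].
    by apply/ffunP => j; rewrite ffunE; apply/esym/eqP/negbFE/all_eq.
  by rewrite eqxx big1 // => j _; rewrite ffunE eqxx.
(* Of the double sum over coordinates, only the term with the indices prescribed by [c] survives. *)
rewrite (bigD1
  [ffun j => c (link (Tagged (fun k => 'I_(nout tau (label k))) j))]) //=.
rewrite (bigD1 [ffun j => c (Tagged (fun k => 'I_(nin tau (label k))) j)]) //=.
have pout (a : {ffun 'I_(nout tau (label k)) -> X}) :
    \prod_j dual_basis (h c (link (Tagged (fun k => 'I_(nout tau (label k))) j)))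
       (vbasis {:W})`_(e (a j)) =
    (a == [ffun j => c (link (Tagged (fun k => 'I_(nout tau (label k))) j))])%:R :> K.
  by rewrite -prodE; apply: eq_bigr => j _; rewrite lfunE /= ffunE coordE.
have pin (b : {ffun 'I_(nin tau (label k)) -> X}) :
    \prod_j coord (vbasis {:W}) (e (b j))
       (vbasis {:W})`_(h c (Tagged (fun k => 'I_(nin tau (label k))) j)) =
    (b == [ffun j => c (Tagged (fun k => 'I_(nin tau (label k))) j)])%:R :> K.
  by rewrite -prodE; apply: eq_bigr => j _; rewrite ffunE coordE eq_sym.
rewrite pout pin !eqxx !mulr1 !big1 ?addr0 // => [a ne|b ne].
  by rewrite big1 // => b _; rewrite pout (negPf ne) mul0r mulr0.
by rewrite pin (negPf ne) !mulr0.
Qed.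

End ArrayStructure.

(** * The scalars determine a diagram up to isomorphism *)

Section Faithful.
Variables (r : nat) (tau : r.-tuple (nat * nat)) (K : fieldType).
Implicit Types D E : diagram tau.

(** Gathering the labels into one type lets boxes with different labels be compared by a boolean
    equality. *)
Definition box_type (X : finType) : finType :=
  {i : 'I_r & ({ffun 'I_(nout tau i) -> X} * {ffun 'I_(nin tau i) -> X})%type}.

Definition mk_box (X : finType) i (a : {ffun 'I_(nout tau i) -> X})
    (b : {ffun 'I_(nin tau i) -> X}) : box_type X :=
  existT (fun i => ({ffun 'I_(nout tau i) -> X} * {ffun 'I_(nin tau i) -> X})%type)
    i (a, b).

Definition box_data (X : finType) D
    (c : {ffun strings (nin tau) (@label _ _ D) -> X}) (k : 'I_(nbox D)) :
    box_type X :=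
  mk_box [ffun j : 'I_(nout tau (label k)) =>
            c (link (Tagged (fun k => 'I_(nout tau (label k))) j))]
         [ffun j : 'I_(nin tau (label k)) =>
            c (Tagged (fun k => 'I_(nin tau (label k))) j)].

(** Comparing string numbers as naturals extracts the content of a dependent equality without
    transport along the equality of labels. *)
Lemma mk_box_eq (X : finType) (u v : box_type X) : u = v ->
  [/\ tag u = tag v,
      forall (j : 'I_(nout tau (tag u))) (j' : 'I_(nout tau (tag v))),
        j = j' :> nat -> (tagged u).1 j = (tagged v).1 j'
    & forall (j : 'I_(nin tau (tag u))) (j' : 'I_(nin tau (tag v))),
        j = j' :> nat -> (tagged u).2 j = (tagged v).2 j'].
Proof. by move=> ->; split=> // j j' /val_inj->. Qed.

(** The tautological colouring, under which the data of a box record the input strings attached to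
    it by incidence or by a link. *)
Definition id_state D : {ffun strings (nin tau) (@label _ _ D) ->
                              strings (nin tau) (@label _ _ D)} := [ffun s => s].

(** The input half of the data forces [c] to be the map of strings induced by [f]; the output half
    says that this map respects links. *)
Definition covering D E (c : {ffun strings (nin tau) (@label _ _ E) ->
                                   strings (nin tau) (@label _ _ D)})
    (f : {ffun 'I_(nbox E) -> 'I_(nbox D)}) : bool :=
  [forall k, box_data c k == box_data (id_state D) (f k)].

Lemma covering_hom D E c f : @covering D E c f -> is_hom f.
Proof.
move=> /forallP cf.
have label_f k : label (f k) = label k.
  by have /eqP/mk_box_eq[] := cf k.
have c_lifts s : lifts f s (c s).
  have [t st] := lifts_ex label_f s.
  suff -> : c s = t by [].
  case: s t st => k j [l j'] /liftsP[/= e]; subst l => jj'.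
  have /eqP/mk_box_eq[_ _ /= /(_ j j' (esym jj'))] := cf k.
  by rewrite !ffunE.
apply/homP; split=> // s t st; suff <- : c (link s) = link t by [].
case: s t st => k j [l j'] /liftsP[/= e]; subst l => jj'.
have /eqP/mk_box_eq[_ /= /(_ j j' (esym jj')) + _] := cf k.
by rewrite !ffunE.
Qed.

Lemma prod_natr_bool (I : finType) (P : pred I) :
  \prod_(i : I) (P i)%:R = [forall i, P i]%:R :> K.
Proof.
case: (boolP [forall i, P i]) => [/forallP allP|/forallPn[i /negPf Pi]].
  by rewrite big1 // => i _; rewrite allP.
by rewrite (bigD1 i) //= Pi mul0r.
Qed.

(** The sum over [l] is what lets a product over the boxes of [E] expand into a sum over maps to the
    boxes of [D]; [g] is the indicator of the allowed images. *)
Definition cover_array D (g : {ffun 'I_(nbox D) -> bool}) :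
    array tau K (strings (nin tau) (@label _ _ D)) := fun i a b =>
  \sum_l (g l && (mk_box a b == box_data (id_state D) l))%:R.

(** Since [c] is determined by [f], counting pairs amounts to counting surjective morphisms. *)
Definition surjective_coverings D E :=
  [set cf : {ffun strings (nin tau) (@label _ _ E) ->
                  strings (nin tau) (@label _ _ D)} *
            {ffun 'I_(nbox E) -> 'I_(nbox D)}
   | covering cf.1 cf.2 && [forall l, l \in codom cf.2]].

(* Inclusion-exclusion over the set of boxes of D switched on by g. *)
Lemma card_surjective_coverings D E :
  #|surjective_coverings D E|%:R =
  \sum_(g : {ffun 'I_(nbox D) -> bool})
    (\prod_l (-1) ^+ (~~ g l)) *
    \sum_(c : {ffun strings (nin tau) (@label _ _ E) ->
                    strings (nin tau) (@label _ _ D)})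
      \prod_k state_weight (cover_array g) c k :> K.
Proof.
(* Distributing the product over the sums in [cover_array] yields a sum over pairs [(c, f)], which
   is then exchanged with the sum over [g]. *)
under [RHS]eq_bigr => g _.
  under [X in _ * X]eq_bigr => c _ do
    rewrite /state_weight /cover_array bigA_distr_bigA.
  rewrite pair_bigA big_distrr /=.
  over.
rewrite exchange_big /= -sum1_card natr_sum big_mkcond /=.
apply: eq_bigr => -[c f] _ /=; rewrite inE /=.
transitivity (\sum_(g : {ffun 'I_(nbox D) -> bool}) (covering c f)%:R *
    \prod_l ((-1) ^+ (~~ g l) * ((l \in codom f) ==> g l)%:R) : K); last first.
  apply: eq_bigr => g _; rewrite big_split /= mulrCA; congr (_ * _).
  rewrite !prod_natr_bool -natrM mulnb; congr (nat_of_bool _)%:R.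
  apply/andP/forallP => [[/forallP cP /forallP gP] k|H].
    by rewrite (implyP (gP _) (codom_f f k)); apply: cP.
  split; apply/forallP.
    by move=> k; have /andP[] := H k.
  by move=> l; apply/implyP => /codomP[k ->]; have /andP[] := H k.
rewrite -big_distrr /=.
(* The signed sum over [g] factors over the boxes [l] of [D]: the factor is 1 on the image of [f]
   and [1 - 1 = 0] off it. *)
rewrite -(bigA_distr_bigA
  (fun l b => (-1) ^+ (~~ b) * ((l \in codom f) ==> b)%:R)) /=.
transitivity ((covering c f)%:R * \prod_l (l \in codom f)%:R : K).
  by rewrite prod_natr_bool -natrM mulnb; case: ifP.
congr (_ * _); apply: eq_bigr => l _; rewrite big_bool /= expr0 expr1 implybT mul1r.
by case: (l \in codom f); rewrite ?mulr0 ?mulr1 ?addr0 ?subrr.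
Qed.

Hypothesis charK : [pchar K] =i pred0.

(** Both diagrams are tested on structures built from [D]. The identity covering makes the count for
    [D] positive, and in characteristic zero it stays nonzero in [K], so the count for [E] is
    positive too. *)
Lemma scalar_eq_surjective_hom D E :
  (forall A : alg_structure tau K, Defs.scalar A D = Defs.scalar A E) ->
  exists2 f : 'I_(nbox E) -> 'I_(nbox D), is_hom f & forall l, l \in codom f.
Proof.
move=> DE.
have cardDE : #|surjective_coverings D D|%:R = #|surjective_coverings D E|%:R :> K.
  rewrite !card_surjective_coverings; apply: eq_bigr => g _; congr (_ * _).
  by have [A AE] := array_structure (cover_array g); rewrite -!AE DE.
have DD_gt0 : (0 < #|surjective_coverings D D|)%N.
  apply/card_gt0P; exists (id_state D, [ffun k => k]); rewrite inE /=.
  apply/andP; split; first by apply/forallP => k; rewrite ffunE.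
  by apply/forallP => l; apply/codomP; exists l; rewrite ffunE.
have : (0 < #|surjective_coverings D E|)%N.
  move: DD_gt0; rewrite !lt0n; apply: contraNneq => DE0.
  by rewrite -((pcharf0P _).1 charK) cardDE DE0.
case/card_gt0P => -[c f]; rewrite inE => /andP[/covering_hom hf /forallP fP].
by exists f.
Qed.

(** Surjections in both directions force equal numbers of boxes, so each of them is bijective. *)
Lemma scalar_eq_iso D E :
  (forall A : alg_structure tau K, Defs.scalar A D = Defs.scalar A E) -> iso D E.
Proof.
move=> DE.
have surj_leq D' E' (f : 'I_(nbox E') -> 'I_(nbox D')) :
    (forall l, l \in codom f) -> (nbox D' <= nbox E')%N.
  move=> fP; rewrite -[nbox D']card_ord -[nbox E']card_ord.
  apply: leq_trans (leq_image_card f _); apply: subset_leq_card.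
  by apply/subsetP => l _; apply: fP.
have [f hf fP] := scalar_eq_surjective_hom (fun A => esym (DE A)).
have [g hg gP] := scalar_eq_surjective_hom DE.
exists f => //.
have eqn : nbox D = nbox E
  by apply/eqP; rewrite eqn_leq (surj_leq _ _ _ fP) (surj_leq _ _ _ gP).
apply: inj_card_bij; last by rewrite !card_ord eqn.
apply/injectiveP; rewrite /injectiveb /dinjectiveb; apply/card_uniqP.
rewrite size_map -cardE; transitivity #|'I_(nbox E)|; last by rewrite !card_ord eqn.
by apply: eq_card => l; rewrite !inE; apply: fP.
Qed.

End Faithful.

(** * The universal property of the free commutative monoid *)

Section CmonomExtension.
Variables (I : choiceType) (M : conomType) (s : I -> M).

Definition mexp (x : M) n : M := iter n (mmul x) mone.

Lemma mexpD x m n : mexp x (m + n) = mmul (mexp x m) (mexp x n).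
Proof. by elim: m => [|m IHm]; rewrite ?addSn /= ?mul1m // IHm mulmA. Qed.

Definition cmonom_ext (u : {cmonom I}) : M :=
  \big[mmul/mone]_(i <- finsupp u) mexp (s i) (u i).

(** Indices off the support contribute a zeroth power, so two monomials can be expanded over a
    common set. *)
Lemma cmonom_extEw (d : {fset I}) (u : {cmonom I}) : (finsupp u `<=` d)%fset ->
  cmonom_ext u = \big[mmul/mone]_(i <- d) mexp (s i) (u i).
Proof.
move=> le_d; apply: big_fset_incl => // i _.
by rewrite -cmE_eq0 => /eqP->.
Qed.

Lemma cmonom_ext1 : cmonom_ext mone = mone.
Proof. by rewrite /cmonom_ext mdom1 big_seq_fset0. Qed.

Lemma cmonom_extM u v :
  cmonom_ext (mmul u v) = mmul (cmonom_ext u) (cmonom_ext v).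
Proof.
rewrite (cmonom_extEw (fsubsetUl (finsupp u) (finsupp v))).
rewrite (cmonom_extEw (fsubsetUr (finsupp u) (finsupp v))).
rewrite /cmonom_ext mdomD -big_split /=; apply: eq_bigr => i _.
by rewrite cmM mexpD.
Qed.

Lemma cmonom_extU i : cmonom_ext (ucm i) = s i.
Proof. by rewrite /cmonom_ext mdomU big_seq_fset1 cmUU /mexp /= mulm1. Qed.

Lemma cmonom_ext_additive (w : M -> nat) u :
  w mone = 0%N -> (forall x y, w (mmul x y) = (w x + w y)%N) ->
  w (cmonom_ext u) = (\sum_(i <- finsupp u) u i * w (s i))%N.
Proof.
move=> w1 wM; rewrite /cmonom_ext (big_morph w wM w1); apply: eq_bigr => i _.
by elim: (u i) => [|n IHn] /=; rewrite ?wM ?IHn // mulSn.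
Qed.

End CmonomExtension.

(** * Functoriality of the monoid algebra *)

Section MonoidAlgebraMap.
Variables (K : fieldType) (M N : conomType) (h : M -> N).
Hypotheses (h1 : h mone = mone) (hM : forall x y, h (mmul x y) = mmul (h x) (h y)).

Definition malg_vec (x : M) : {malg K[N]} := << h x >>.

Fact malg_vec_mmorphism : mmorphism malg_vec.
Proof.
split=> [x y|]; last by rewrite /malg_vec h1.
by rewrite /malg_vec hM malgM_def fgmulUU mulr1.
Qed.
HB.instance Definition _ := isMultiplicative.Build M {malg K[N]} malg_vec
  malg_vec_mmorphism.

Definition malg_map : {malg K[M]} -> {malg K[N]} := mmap (@malgC N K) malg_vec.

HB.instance Definition _ := GRing.RMorphism.on malg_map.

Fact malg_map_scalable : scalable malg_map.
Proof. by move=> c g; rewrite /malg_map mmapZ mul_malgC. Qed.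
HB.instance Definition _ := GRing.isScalable.Build K {malg K[M]} {malg K[N]} *:%R
  malg_map malg_map_scalable.

Lemma malg_lrmorphism_ex :
  exists phi : {lrmorphism {malg K[M]} -> {malg K[N]}},
    forall c x, phi << c *g x >> = << c *g h x >>.
Proof.
exists malg_map => c x.
by rewrite /= /malg_map mmapU malgM_def fgmulUU mul1m mulr1.
Qed.

End MonoidAlgebraMap.

(** The inverse of [h] is again a monoid morphism; the algebra map it induces inverts [phi] on basis
    elements, hence everywhere by additivity. *)
Lemma malg_lrmorphism_bij (K : fieldType) (M N : conomType) (h : M -> N)
    (phi : {lrmorphism {malg K[M]} -> {malg K[N]}}) :
    h mone = mone -> (forall x y, h (mmul x y) = mmul (h x) (h y)) ->
    bijective h -> (forall c x, phi << c *g x >> = << c *g h x >>) ->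
  bijective phi.
Proof.
move=> h1 hM [h' hK h'K] phiU.
have h'1 : h' mone = mone by rewrite -h1 hK.
have h'M x y : h' (mmul x y) = mmul (h' x) (h' y).
  by rewrite -{1}(h'K x) -{1}(h'K y) -hM hK.
have [psi psiU] := malg_lrmorphism_ex K h'1 h'M.
exists psi => g; rewrite [in LHS](monalgE g) [RHS]monalgE !raddf_sum /=.
  by apply: eq_bigr => x _; rewrite phiU psiU hK.
by apply: eq_bigr => x _; rewrite psiU phiU h'K.
Qed.

(** * Unique factorization into connected diagrams *)

Section UniqueDecomposition.
Variables (K : fieldType) (r : nat) (tau : r.-tuple (nat * nat)).
Hypothesis charK : [pchar K] =i pred0.
Implicit Types C D E : diagram tau.
Local Open Scope quotient_scope.

Notation dclass := (diag_class tau K).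

Lemma class_iso D E : iso D E -> \pi_dclass D = \pi_dclass E.
Proof. by move=> i; apply/eqP/diag_equivP => A; apply: scalar_iso. Qed.

Lemma iso_repr D : iso (repr (\pi_dclass D)) D.
Proof. by apply: (scalar_eq_iso charK) => A; apply: scalar_repr. Qed.

(** For connected [C] this is the multiplicity of [C] in [x] times the number of automorphisms of
    [C]. *)
Definition component_weight C (x : dclass) : nat := #|embeddings C (repr x)|.

Lemma component_weight_pi C D :
  component_weight C (\pi_dclass D) = #|embeddings C D|.
Proof. exact: card_embeddings_iso (iso_repr D). Qed.

Lemma component_weight1 C : (0 < nbox C)%N -> component_weight C mone = 0%N.
Proof.
move=> C_gt0; rewrite [mone]/(class_one tau K) component_weight_pi.
apply/eqP; rewrite -leqn0 leqNgt; apply/negP => /card_gt0P[f _].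
by case: (f (Ordinal C_gt0)).
Qed.

Lemma component_weightM C x y : connected C ->
  component_weight C (mmul x y) = (component_weight C x + component_weight C y)%N.
Proof.
move=> C_conn; rewrite [mmul x y]/(class_mul x y) component_weight_pi.
exact: card_embeddings_juxt.
Qed.

Notation decomposition := (cmonom_ext (val : connected_diag tau K -> dclass)).

(** The weight attached to the generator [s] vanishes on all other generators and is positive on
    [s], so it recovers the exponent of [s]. *)
Lemma decomposition_inj : injective decomposition.
Proof.
move=> u v uv; apply/eqP/cmP => s.
have /asboolP[C C_conn Cs] := valP s.
have C_gt0 : (0 < nbox C)%N by case/andP: C_conn.
have weight_s w : component_weight C (decomposition w) =
                  (w s * component_weight C (val s))%N.
  rewrite (cmonom_ext_additive _ _ (component_weight1 C_gt0)); last first.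
    by move=> x y; apply: component_weightM.
  (* Adjoining [s] to the support covers the case where its exponent is zero. *)
  rewrite (big_fset_incl _ (fsubsetUl (finsupp w) [fset s])%fset); last first.
    by move=> t _; rewrite -cmE_eq0 => /eqP->.
  rewrite (big_fsetD1 s) ?inE ?eqxx ?orbT //= big1_fset ?addn0 // => t.
  rewrite !inE => /andP[ts _] _.
  have /asboolP[D D_conn Dt] := valP t.
  suff -> : component_weight C (val t) = 0%N by rewrite muln0.
  apply/eqP; rewrite -leqn0 leqNgt Dt component_weight_pi; apply/negP.
  move=> /(embeddings_connected_iso C_gt0 D_conn)/class_iso; rewrite -Cs -Dt.
  by move/val_inj => st; rewrite st eqxx in ts.
have : component_weight C (decomposition u) = component_weight C (decomposition v).
  by rewrite uv.
rewrite !weight_s => /eqP; rewrite eqn_pmul2r => [/eqP//|].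
by rewrite Cs component_weight_pi card_embeddings_self_gt0.
Qed.

(** Strong induction on the number of boxes: the empty diagram is the empty product, a connected one
    is a generator, and any other splits into two smaller ones. *)
Lemma decomposition_surj x : exists u, decomposition u = x.
Proof.
elim/quotW: x => D; have [n] := ubnP (nbox D).
elim: n D => // n IHn D; rewrite ltnS => Dn.
have [D0|D_gt0] := posnP (nbox D).
  exists mone; rewrite cmonom_ext1 [LHS]/(class_one tau K).
  by apply/eqP/diag_equivP => A; rewrite !scalar_nbox0.
have [D_conn|/(not_connected_split D_gt0)[D1 [D2 [/class_iso <- n1 n2]]]] :=
  boolP (connected D).
  have Dc : connected_class (\pi_dclass D) by apply/asboolP; exists D.
  by exists (ucm (exist (fun x : dclass => connected_class x) _ Dc
               : connected_diag tau K)); rewrite cmonom_extU.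
have [u1 e1] := IHn _ (leq_trans n1 Dn); have [u2 e2] := IHn _ (leq_trans n2 Dn).
exists (mmul u1 u2); rewrite cmonom_extM e1 e2; exact: class_mul_pi.
Qed.

Lemma decomposition_bij : bijective decomposition.
Proof.
have [g gK] := choice decomposition_surj.
by exists g => // u; apply: decomposition_inj; rewrite gK.
Qed.

End UniqueDecomposition.

Theorem proposition1p4 (K : closedFieldType) (charK : [pchar K] =i pred0)
    (r : nat) (tau : r.-tuple (nat * nat)) :
  exists phi : {lrmorphism {malg K[{cmonom connected_diag tau K}]} ->
                           diagram_algebra tau K},
    (forall s : connected_diag tau K, phi << ucm s >> = diag_vec (val s)) /\
    bijective phi.
Proof.
(* The polynomial algebra is the monoid algebra of the free commutative monoid on the connected
   classes, so it suffices that [h] is an isomorphism of monoids. *)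
pose h := cmonom_ext (val : connected_diag tau K -> diag_class tau K).
have h1 : h mone = mone := cmonom_ext1 _.
have hM x y : h (mmul x y) = mmul (h x) (h y) := cmonom_extM _ _ _.
have [phi phiU] := malg_lrmorphism_ex K h1 hM.
exists phi; split=> [s|]; first by rewrite phiU /h cmonom_extU.
exact: malg_lrmorphism_bij h1 hM (decomposition_bij tau charK) phiU.
Qed.
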